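(* Let $\kappa\ge0$ be an integer and $E>0$ a real number. Then the formal series $$|E,\kappa\rangle_{even}=(2E)^{3\kappa}e^{-E}\sum_{n=0}^{\infty}L_n^{6\kappa+3}(2E)\Big(|n,2\kappa\rangle+\sum_{t=1}^{\kappa}\Gamma^{even}_{\kappa-1,\kappa-t}|n+3t,2\kappa-2t\rangle\Big),$$ $$|E,\kappa\rangle_{odd}=(2E)^{3\kappa+\frac32}e^{-E}\sum_{n=0}^{\infty}L_n^{6\kappa+6}(2E)\Big(|n,2\kappa+1\rangle+\sum_{t=1}^{\kappa}\Gamma^{odd}_{\kappa-1,\kappa-t}|n+3t,2\kappa-2t+1\rangle\Big),$$ with $\Gamma^{even}_{\kappa-1,t}=(-24)^{t-\kappa}\frac{(\kappa+t)!}{(\kappa-t)!(2t)!}$ and $\Gamma^{odd}_{\kappa-1,t}=(-24)^{t-\kappa}\frac{(\kappa+t+1)!}{(\kappa-t)!(2t+1)!}$, are (infinite cut-off) solutions of $H|E\rangle=E|E\rangle$ in the bosonic sector of the $SU(3)$ model; that is, for each of the two series its coefficients $a_{j,k}$ in $\sum_{j,k\ge0}a_{j,k}|j,k\rangle$ satisfy, for all integers $j,k\ge0$, $$a_{j-1,k}-(2j+3k+4-2E)a_{j,k}+(j+1)(j+3k+4)a_{j+1,k}+\tfrac38(k+1)(k+2)a_{j-2,k+2}=0,$$ where $a_{j,k}=0$ if $j<0$ or $k<0$.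
   Context: Model. Let $T^A$, $A=1,\dots,8$, be the generators of $SU(3)$ in the fundamental representation with $\mathrm{tr}(T^AT^B)=\frac12\delta_{AB}$, $[a_A,a_B^\dagger]=\delta_{AB}$, $a=\sum_Aa_AT^A$, $a^\dagger=\sum_Aa_A^\dagger T^A$, $(O)$ the trace of a product of such matrices, $|0\rangle$ the Fock vacuum, and $H=(a^\dagger a)+2-\frac12(a^\dagger a^\dagger)-\frac12(aa)$. $|j,k\rangle=(a^\dagger a^\dagger)^j(a^\dagger a^\dagger a^\dagger)^k|0\rangle$ for $j,k\ge0$. The displayed recursion is the eigenvalue equation $H|E\rangle=E|E\rangle$ written coefficientwise in the $|j,k\rangle$. Rescaled Laguerre polynomials: $L_n^\alpha(x)=\sum_{i=0}^n\frac{(-x)^i}{i!\,(n-i)!\,\Gamma(\alpha+i+1)}$. *)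

(* Defs.v *)
From HB Require Import structures.
From mathcomp Require Import all_boot all_order all_algebra.
From mathcomp Require Import all_classical all_reals all_analysis.

Set Implicit Arguments.
Unset Strict Implicit.
Unset Printing Implicit Defensive.

Import Order.TTheory GRing.Theory Num.Theory.
Import numFieldNormedType.Exports.

Local Open Scope classical_set_scope.
Local Open Scope ring_scope.

(** Euler's Gamma function; meaningful for [0 < z] only, since the integral
    diverges otherwise. *)
Definition Gamma (R : realType) (z : R) : R :=
  (\int[lebesgue_measure]_(x in `[0, +oo[) (x `^ (z - 1) * expR (- x)))%R.

(** The "rescaled" Laguerre polynomial: the usual generalized Laguerre
    polynomial divided by [Gamma (alpha + n + 1)]. *)
Definition laguerre (R : realType) (n : nat) (alpha x : R) : R :=
  \sum_(i < n.+1)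
    (- x) ^+ i / (i`!%:R * (n - i)`!%:R * Gamma (alpha + i%:R + 1)).

(** A formal series [\sum_(j, k >= 0) a_(j,k) |j,k>] is represented by its array
    of coefficients [a]; no convergence is required. *)
Definition fseries (R : realType) := nat -> nat -> R^o.

Definition ket (R : realType) (j k : nat) : fseries R :=
  fun j' k' => ((j' == j) && (k' == k))%:R.

(** [s] is the formal sum [\sum_(n >= 0) u n]: each coefficient of the partial
    sums is eventually constant, equal to that of [s]. *)
Definition is_formal_sum (R : realType) (u : nat -> fseries R) (s : fseries R) :
    Prop :=
  forall j k : nat, \forall N \near \oo, (\sum_(n < N) u n) j k = s j k.

Lemma is_formal_sum_unique (R : realType) (u : nat -> fseries R)
  (s s' : fseries R) : is_formal_sum u s -> is_formal_sum u s' -> s = s'.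
Proof.
move=> us us'; apply/funext => j; apply/funext => k.
have [N [<- <-]] : exists N, (\sum_(n < N) u n) j k = s j k /\
    (\sum_(n < N) u n) j k = s' j k.
  by apply: (@filter_ex _ \oo); apply: filterI; [exact: us|exact: us'].
by [].
Qed.

(** [GammaEven kappa t] and [GammaOdd kappa t] are the coefficients written
    [Gamma_{kappa - 1, t}] (the first index is shifted by one); they are used
    for [t < kappa] only, so [kappa - t] is not truncated and the power of
    [-24] is negative. *)
Definition GammaEven (R : realType) (kappa t : nat) : R :=
  (- 24%:R) ^ (t%:Z - kappa%:Z) *
  ((kappa + t)`!%:R / ((kappa - t)`!%:R * (2 * t)`!%:R)).

Definition GammaOdd (R : realType) (kappa t : nat) : R :=
  (- 24%:R) ^ (t%:Z - kappa%:Z) *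
  ((kappa + t + 1)`!%:R / ((kappa - t)`!%:R * (2 * t + 1)`!%:R)).

Definition even_term (R : realType) (kappa : nat) (E : R) (n : nat) : fseries R :=
  laguerre n (6 * kappa + 3)%:R (2 * E) *:
    (ket R n (2 * kappa)%N +
     \sum_(1 <= t < kappa.+1)
       GammaEven R kappa (kappa - t) *: ket R (n + 3 * t)%N (2 * kappa - 2 * t)%N).

Definition odd_term (R : realType) (kappa : nat) (E : R) (n : nat) : fseries R :=
  laguerre n (6 * kappa + 6)%:R (2 * E) *:
    (ket R n (2 * kappa + 1)%N +
     \sum_(1 <= t < kappa.+1)
       GammaOdd R kappa (kappa - t) *:
         ket R (n + 3 * t)%N (2 * kappa - 2 * t + 1)%N).

Definition is_even_state (R : realType) (kappa : nat) (E : R) (a : fseries R) :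
    Prop :=
  exists2 s, is_formal_sum (even_term kappa E) s &
    a = ((2 * E) ^+ (3 * kappa) * expR (- E)) *: s.

Definition is_odd_state (R : realType) (kappa : nat) (E : R) (a : fseries R) :
    Prop :=
  exists2 s, is_formal_sum (odd_term kappa E) s &
    a = ((2 * E) `^ (3 * kappa%:R + 3 / 2) * expR (- E)) *: s.

(** Coefficients extended by [0] to negative indices. *)
Definition coef (R : realType) (a : fseries R) (j k : int) : R :=
  match j, k with
  | Posz j', Posz k' => a j' k'
  | _, _ => 0
  end.

(** The equation [H |E> = E |E>] written coefficientwise in the [|j,k>], with
    [H = (a^+ a) + 2 - 1/2 (a^+ a^+) - 1/2 (a a)]; the matrix elements of
    [- 2 (H - E)] are those given by
    [(a^+ a^+) |j,k> = |j+1,k>], [(a^+ a) |j,k> = (j + 3k/2) |j,k>] and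
    [(a a) |j,k> = j (j + 3k + 3) |j-1,k> + 3/8 k (k - 1) |j+2,k-2>]. *)
Definition is_eigenstate (R : realType) (E : R) (a : fseries R) : Prop :=
  forall j k : nat,
    coef a (j%:Z - 1) k%:Z
    - (2 * j%:R + 3 * k%:R + 4 - 2 * E) * coef a j%:Z k%:Z
    + (j%:R + 1) * (j%:R + 3 * k%:R + 4) * coef a (j%:Z + 1) k%:Z
    + 3 / 8 * (k%:R + 1) * (k%:R + 2) * coef a (j%:Z - 2) (k%:Z + 2) = 0.

(* Main.v *)
(** Put [m = 2 kappa] or [m = 2 kappa + 1] and [x = 2 E].  In both parities the
    coefficient of [|n + 3t, m - 2t>] is [c_t L_n^(3m+3)(x)] with
    [c_t = (-24)^(-t) (m - t)! / (t! (m - 2t)!)].  At [j = n + 3t] and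
    [k = m - 2t] one has
      [(j + 1)(j + 3k + 4) = (n + 1)(n + 3m + 4) + 9t(m - t + 1)],
    so that the recursion is [c_t] times the three-term Laguerre recurrence plus
    [L_(n+1)] times
      [9t(m - t + 1) c_t + 3/8 (k + 1)(k + 2) c_(t-1) = 0]. *)
Require Import Defs.
From mathcomp Require Import all_boot all_order all_algebra.
From mathcomp Require Import all_classical all_reals all_analysis.
From mathcomp Require Import ring zify.

Import Order.TTheory GRing.Theory Num.Theory.
Import numFieldNormedType.Exports.
Local Open Scope ring_scope.

(** * The Gamma function at positive integers *)

(** The exponential series gives x^(n+1)/(n+1)! <= e^x for x > 0, which squeezes the function
    between 0 and (n+1)!/x. *)
Lemma cvgr_exprnM_expRN (R : realType) (n : nat) :
  ((x : R) ^+ n * expR (- x) @[x --> +oo] --> (0 : R))%classic.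
Proof.
apply: (@squeeze_cvgr _ _ _ _ (cst 0) (fun x => n.+1`!%:R * x^-1)); last 2 first.
- exact: cvg_cst.
- rewrite -(mulr0 (n.+1`!%:R)); apply: cvgMr.
  apply/gtr0_cvgV0; last exact: cvg_id.
  exact: nbhs_pinfty_gt.
near=> x.
have x0 : 0 < x by near: x; exact: nbhs_pinfty_gt.
rewrite mulr_ge0 ?exprn_ge0 ?expR_ge0 ?(ltW x0)//= expRN ler_pdivrMr ?expR_gt0//.
have : x ^+ n.+1 / n.+1`!%:R <= expR x.
  by apply: le_trans (expR_ge1Dxn n (ltW x0)); rewrite lerDr.
rewrite ler_pdivrMr ?ltr0n ?fact_gt0// exprSr => xe.
by rewrite mulrAC ler_pdivlMr// [leRHS]mulrC.
Unshelve. all: by end_near. Qed.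

(* Built by induction on [n] through integration by parts. *)
Lemma exprnM_expRN_antiderivative (R : realType) (n : nat) :
  exists F : R -> R, [/\ forall x : R, is_derive x (1 : R) F (x ^+ n * expR (- x)),
    F 0 = - n`!%:R & (F x @[x --> +oo] --> (0 : R))%classic].
Proof.
elim: n => [|n [F [dF F0 Foo]]].
  exists (fun x => - expR (- x)); split.
  - by move=> x; apply: is_derive_eq; rewrite expr0 mul1r; ring.
  - by rewrite oppr0 expR0.
  - by rewrite -oppr0; apply: cvgN; exact: cvgr_expR.
exists (fun x => n.+1%:R * F x - x ^+ n.+1 * expR (- x)); split.
- move=> x.
  have dE : is_derive x (1 : R) (fun y : R => expR (- y)) (- expR (- x)).
    by apply: is_derive_eq; rewrite mulrN1.
  have dX : is_derive x (1 : R) (fun y : R => y ^+ n.+1) (n.+1%:R * x ^+ n).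
    have := is_deriveX n.+1 (is_derive_id x (1 : R)).
    by rewrite exprfctE/= /GRing.scale/= mulr1.
  apply: (is_derive_eq (is_deriveB (is_deriveZ n.+1%:R (dF x))
    (is_deriveM dX dE))).
  rewrite /GRing.scale/=.
  by rewrite exprS; ring.
- by rewrite F0 expr0n mul0r subr0 mulrN -natrM.
- rewrite -[X in (_ --> X)%classic](subr0 0) -[X in X - _](mulr0 n.+1%:R).
  apply: cvgB; first exact: cvgMr.
  exact: cvgr_exprnM_expRN.
Qed.

(** The integral over [0, +oo[ is the limit of the antiderivative at infinity minus its value at 0,
    that is 0 - (- n!). *)
Lemma Gamma_natE (R : realType) (n : nat) : Gamma n.+1%:R = n`!%:R :> R.
Proof.
have [F [dF F0 Foo]] := exprnM_expRN_antiderivative R n.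
have cf : continuous (fun x : R => x ^+ n * expR (- x)).
  move=> x; apply: differentiable_continuous.
  apply/derivable1_diffP; apply: derivableM.
    exact: exprn_derivable.
  exact: ex_derive.
have cF : continuous F.
  move=> x; apply: differentiable_continuous.
  by apply/derivable1_diffP; apply: ex_derive.
transitivity (\int[lebesgue_measure]_(x in `[(0 : R), +oo[%classic)
  (x ^+ n * expR (- x))).
  apply: eq_Rintegral => x; rewrite inE/= in_itv/= andbT => x0.
  by rewrite -natr1 addrK powR_mulrn.
rewrite (@Rintegral_ge0_continuous_FTC2y _ _ F _ 0)//.
- by rewrite F0 sub0r opprK.
- by move=> x x0; rewrite mulr_ge0 ?exprn_ge0 ?expR_ge0.
- exact: continuous_subspaceT.
- by apply: cvg_at_right_filter; exact: cF.
- by move=> x _; rewrite derive1E derive_val.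
Qed.

(** * Three-term recurrence for the rescaled Laguerre polynomials *)

(** The indicator is needed because [n - i] is truncated. *)
Definition laguerre_coef (R : realType) (a n i : nat) : R :=
  (i <= n)%:R / (i`!%:R * (n - i)`!%:R * (a + i)`!%:R).

(** Padding with zero coefficients puts polynomials of different degrees on one index range, ready
    for comparing coefficients of powers of -x. *)
Lemma laguerre_natE (R : realType) (a n N : nat) (x : R) : (n < N)%N ->
  laguerre n a%:R x = \sum_(i < N) laguerre_coef R a n i * (- x) ^+ i.
Proof.
move=> nN; rewrite /laguerre (big_ord_widen_cond N xpredT
  (fun i => (- x) ^+ i / (i`!%:R * (n - i)`!%:R * Gamma (a%:R + i%:R + 1))))//.
rewrite big_mkcond; apply: eq_bigr => i _.
rewrite -natrD natr1 Gamma_natE /laguerre_coef ltnS.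
by case: leqP => _; rewrite ?mul0r// mul1r mulrC.
Qed.

Lemma factS_natr (R : realType) (n : nat) : n.+1`!%:R = n.+1%:R * n`!%:R :> R.
Proof. by rewrite factS natrM. Qed.

Lemma laguerre_coef_rec0 (R : realType) (a n : nat) :
  n.+2%:R * (n + a).+2%:R * laguerre_coef R a n.+2 0 =
  (2 * n + a + 3)%:R * laguerre_coef R a n.+1 0 - laguerre_coef R a n 0.
Proof.
rewrite /laguerre_coef !leq0n !subn0 addn0 !factS_natr.
have fn0 k : k`!%:R != 0 :> R by rewrite pnatr_eq0 -lt0n fact_gt0.
have n1 : n.+1%:R != 0 :> R by rewrite pnatr_eq0.
have n2 : n.+2%:R != 0 :> R by rewrite pnatr_eq0.
rewrite -!natr1 in n1 n2 *.
rewrite (natrD _ (2 * n + a)) (natrD _ (2 * n)) natrM -!natr1 natrD.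
by field; rewrite !fn0 n1 n2.
Qed.

(** This compares coefficients of (-x)^(i+1); the product -x L_(n+1) contributes the coefficient of
    index i. *)
Lemma laguerre_coef_rec (R : realType) (a n i : nat) :
  n.+2%:R * (n + a).+2%:R * laguerre_coef R a n.+2 i.+1 =
  (2 * n + a + 3)%:R * laguerre_coef R a n.+1 i.+1 + laguerre_coef R a n.+1 i
  - laguerre_coef R a n i.+1.
Proof.
have fn0 k : k`!%:R != 0 :> R by rewrite pnatr_eq0 -lt0n fact_gt0.
have sn0 k : 1 + k%:R != 0 :> R by rewrite addrC natr1 pnatr_eq0.
rewrite /laguerre_coef addnS.
(* Generic degree: writing n = i + 1 + m removes the truncated subtractions. *)
have [lein|] := leqP i.+1 n.
  have [m ->] : exists m, n = (i.+1 + m)%N by exists (n - i.+1)%N; lia.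
  have -> : ((i.+1 + m).+2 - i.+1 = m.+2)%N by lia.
  have -> : ((i.+1 + m).+1 - i.+1 = m.+1)%N by lia.
  have -> : ((i.+1 + m).+1 - i = m.+2)%N by lia.
  have -> : ((i.+1 + m) - i.+1 = m)%N by lia.
  have -> : (i < (i.+1 + m).+2)%N by lia.
  have -> : (i < (i.+1 + m).+1)%N by lia.
  have -> : (i <= (i.+1 + m).+1)%N by lia.
  rewrite !factS_natr.
  have -> : (m.+2)%:R = 1 + m.+1%:R :> R by rewrite addrC natr1.
  have Em : (m.+1)%:R = 1 + m%:R :> R by rewrite addrC natr1.
  have -> : (i.+1)%:R = 1 + i%:R :> R by rewrite addrC natr1.
  have Ea : ((a+i).+1)%:R = 1 + (a+i)%:R :> R by rewrite addrC natr1.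
  have := sn0 m.+1; have := sn0 m; have := sn0 i; have := sn0 (a + i)%N.
  rewrite Ea Em -!natr1 !natrD -!natr1 !natrD => h1 h2 h3 h4.
  by field; rewrite ?fn0 ?h1 ?h2 ?h3 ?h4.
(* Case i = n: L_n has no term of degree n + 1. *)
rewrite leq_eqVlt => /orP[/eqP/eq_add_S ->|].
  have -> : (i.+2 - i.+1 = 1)%N by lia.
  have -> : (i.+1 - i.+1 = 0)%N by lia.
  have -> : (i.+1 - i = 1)%N by lia.
  rewrite !leqnSn !leqnn mul0r subr0 !factS_natr fact0.
  have -> : (i.+1)%:R = 1 + i%:R :> R by rewrite addrC natr1.
  have Ea : ((a+i).+1)%:R = 1 + (a+i)%:R :> R by rewrite addrC natr1.
  have := sn0 i; have := sn0 (a + i)%N.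
  rewrite Ea -!natr1 !natrD -!natr1 => h1 h2.
  by field; rewrite ?fn0 ?h1 ?h2.
(* Case i = n + 1: only the leading terms of L_(n+2) and -x L_(n+1) survive. *)
rewrite ltnS leq_eqVlt => /orP[/eqP <-|].
  have -> : (n.+2 - n.+2 = 0)%N by lia.
  have -> : (n.+1 - n.+1 = 0)%N by lia.
  rewrite !leqnn ltnn !mul0r mulr0 add0r subr0 !factS_natr fact0.
  rewrite addnS [(n + a)%N]addnC !factS_natr.
  have pn0 k : k.+1%:R != 0 :> R by rewrite pnatr_eq0.
  move: n.+2%:R n.+1%:R (a + n).+2%:R (a + n).+1%:R n`!%:R (a + n)`!%:R
    (pn0 n.+1) (pn0 n) (pn0 (a + n).+1) (pn0 (a + n)%N) (fn0 n) (fn0 (a + n)%N).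
  by move=> *; field; do ?[apply/andP; split].
move=> ni.
have -> : (i < n.+1)%N = false by lia.
have -> : (i < n.+2)%N = false by lia.
have -> : (i <= n.+1)%N = false by lia.
by rewrite !mul0r; ring.
Qed.

(** This is the classical recurrence after division of each polynomial by its factor Gamma(a + n +
    1). *)
Lemma laguerre_recS (R : realType) (a n : nat) (x : R) :
  n.+2%:R * (n + a).+2%:R * laguerre n.+2 a%:R x =
  ((2 * n + a + 3)%:R - x) * laguerre n.+1 a%:R x - laguerre n a%:R x.
Proof.
rewrite (@laguerre_natE _ _ n.+2 n.+3)// (@laguerre_natE _ _ n n.+3)//; last by lia.
have -> : ((2 * n + a + 3)%:R - x) * laguerre n.+1 a%:R x =
    (2 * n + a + 3)%:R * (\sum_(i < n.+3) laguerre_coef R a n.+1 i * (- x) ^+ i) +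
    \sum_(i < n.+2) laguerre_coef R a n.+1 i * (- x) ^+ i.+1.
  rewrite mulrBl -laguerre_natE// -mulNr; congr (_ + _).
  rewrite (@laguerre_natE _ _ n.+1 n.+2)// mulr_sumr.
  by apply: eq_bigr => i _; rewrite exprS mulrCA.
have := laguerre_coef_rec R a n; have := laguerre_coef_rec0 R a n.
move: (_ * (n + a).+2%:R) (2 * n + a + 3)%:R => K C rec0 recS.
(* The constant terms are covered by [rec0]; here are all higher powers. *)
have key : K * \sum_(i < n.+2) laguerre_coef R a n.+2 i.+1 * (- x) ^+ i.+1 =
    C * (\sum_(i < n.+2) laguerre_coef R a n.+1 i.+1 * (- x) ^+ i.+1) +
    \sum_(i < n.+2) laguerre_coef R a n.+1 i * (- x) ^+ i.+1 -
    \sum_(i < n.+2) laguerre_coef R a n i.+1 * (- x) ^+ i.+1.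
  rewrite !mulr_sumr -big_split -sumrB; apply: eq_bigr => i _ /=.
  by rewrite mulrA recS; ring.
rewrite !(big_ord_recl n.+2)/= !expr0 !mulr1 !mulrDr rec0.
by rewrite key; ring.
Qed.

Lemma laguerre_rec0 (R : realType) (a : nat) (x : R) :
  a.+1%:R * laguerre 1 a%:R x = (a.+1%:R - x) * laguerre 0 a%:R x.
Proof.
rewrite (@laguerre_natE _ _ 1 2)// (@laguerre_natE _ _ 0 1)//.
rewrite !big_ord_recl !big_ord0 /laguerre_coef/= !addn0 !addn1 (factS_natr R a).
have fn0 : a`!%:R != 0 :> R by rewrite pnatr_eq0 -lt0n fact_gt0.
have a0 : a.+1%:R != 0 :> R by rewrite pnatr_eq0.
rewrite expr0 expr1.
move: a.+1%:R a`!%:R fn0 a0 => b c b0 c0.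
have -> : bump 0 0 = 1%N by [].
rewrite subnn (_ : 0`! = 1%N)// (_ : 1`! = 1%N)//.
by field; rewrite b0 c0.
Qed.

(** The [match] reads L_(-1) as 0, which lets one formula cover n = 0 as well. *)
Lemma laguerre_rec (R : realType) (a n : nat) (x : R) :
  n.+1%:R * (n + a).+1%:R * laguerre n.+1 a%:R x =
  ((2 * n + a + 1)%:R - x) * laguerre n a%:R x -
  (if n is n'.+1 then laguerre n' a%:R x else 0).
Proof.
case: n => [|n]; first by rewrite muln0 !add0n mul1r subr0 addn1 laguerre_rec0.
by rewrite laguerre_recS; congr ((_%:R - _) * _ - _); lia.
Qed.

(** * The coefficients c_t and the state they define *)

(** Expressing c_t through m serves both parities at once. *)
Definition ket_coef (R : realType) (m t : nat) : R :=
  ((- 24%:R) ^+ t)^-1 * ((m - t)`!%:R / (t`!%:R * (m - 2 * t)`!%:R)).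

Lemma ket_coef0 (R : realType) (m : nat) : ket_coef R m 0 = 1.
Proof. by rewrite /ket_coef expr0 invr1 !mul1r muln0 !subn0 mulfV. Qed.

(** The ratio c_(t+1)/c_t is -(k+1)(k+2) / (24 (t+1)(k+t+2)) with k = m - 2(t+1), and 9/24 = 3/8. *)
Lemma ket_coef_rec (R : realType) (k t : nat) :
  3 * t.+1%:R * (3 * (k + t + 2)%:R) * ket_coef R (k + 2 * t.+1) t.+1 =
  - (3 / 8 * (k%:R + 1) * (k%:R + 2) * ket_coef R (k + 2 * t.+1) t).
Proof.
rewrite /ket_coef.
have -> : (k + 2 * t.+1 - t.+1 = (k + t).+1)%N by lia.
have -> : (k + 2 * t.+1 - t = (k + t).+2)%N by lia.
have -> : (k + 2 * t.+1 - 2 * t.+1 = k)%N by lia.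
have -> : (k + 2 * t.+1 - 2 * t = k.+2)%N by lia.
have fn0 n : n`!%:R != 0 :> R by rewrite pnatr_eq0 -lt0n fact_gt0.
have e0 : (- 24%:R) ^+ t != 0 :> R by rewrite expf_neq0// oppr_eq0 pnatr_eq0.
rewrite !factS_natr exprS.
have E2 n : n.+2%:R = n%:R + 2 :> R by rewrite -!natr1; ring.
have -> : (k + t + 2)%:R = (k + t).+2%:R :> R by rewrite !addn2.
have ht : t.+1%:R != 0 :> R by rewrite pnatr_eq0.
have h1 : k.+1%:R != 0 :> R by rewrite pnatr_eq0.
have h2 : k.+2%:R != 0 :> R by rewrite pnatr_eq0.
rewrite natr1 -(E2 k).
move: k.+1%:R k.+2%:R t.+1%:R (k + t).+2%:R (k + t).+1%:R (k + t)`!%:R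
  h1 h2 ht => a b c d e1 e2.
move: (fn0 t) (fn0 k).
move: t`!%:R k`!%:R => f g f0 g0 a0 b0 c0.
by field; rewrite g0 a0 b0 f0 e0 c0.
Qed.

(** The kets |n + 3t, m - 2t> are pairwise distinct: k determines t, then j determines n, so each
    coefficient is a single product c_t L_n or 0. *)
Definition state (R : realType) (m : nat) (L : nat -> R) : fseries R :=
  fun j k => let t := (m - k)./2 in
  if [&& k <= m, ~~ odd (m - k) & 3 * t <= j]%N
  then ket_coef R m t * L (j - 3 * t)%N else 0.

Lemma stateE (R : realType) (m : nat) (L : nat -> R) (j t : nat) : (2 * t <= m)%N ->
  state R m L j (m - 2 * t)%N =
  if (3 * t <= j)%N then ket_coef R m t * L (j - 3 * t)%N else 0.
Proof.
by move=> tm; rewrite /state subKn// leq_subr/= mul2n odd_double/= doubleK.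
Qed.

Lemma state_out (R : realType) (m : nat) (L : nat -> R) (j k : nat) :
  (forall t, (2 * t <= m)%N -> k <> (m - 2 * t)%N) -> state R m L j k = 0.
Proof.
move=> kt; rewrite /state; case: ifP => // /and3P[km mk _].
by exfalso; apply: (kt (m - k)./2); lia.
Qed.

Lemma ladder_dec (m k : nat) : (exists2 t, (2 * t <= m)%N & k = (m - 2 * t)%N) \/
  (forall t, (2 * t <= m)%N -> k <> (m - 2 * t)%N).
Proof.
have [km|] := boolP ((k <= m) && ~~ odd (m - k))%N.
  by left; exists (m - k)./2; lia.
by move=> h; right => t tm kE; move: h; lia.
Qed.

(** Only n = j - 3t <= j can contribute to |j,k>, so the coefficient is constant once N > j. *)
Lemma state_formal_sum (R : realType) (m : nat) (L : nat -> R) :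
  is_formal_sum (fun n => L n *: (ket R n m +
    \sum_(1 <= t < m./2.+1) ket_coef R m t *: ket R (n + 3 * t) (m - 2 * t)))
    (state R m L).
Proof.
move=> j k; exists j.+1 => // N /= jN.
transitivity (\sum_(n < N) \sum_(t < m./2.+1)
    L n * (ket_coef R m t * ((j == n + 3 * t) && (k == m - 2 * t))%N%:R)).
  rewrite (_ : (\sum_(n < N) _) j k = \sum_(n < N)
    (L n *: (ket R n m + \sum_(1 <= t < m./2.+1)
       ket_coef R m t *: ket R (n + 3 * t) (m - 2 * t))) j k); last first.
    by rewrite !fct_sumE.
  apply: eq_bigr => n _; rewrite -mulr_sumr.
  (* Since c_0 = 1, the isolated ket |n,m> is the term t = 0. *)
  rewrite big_ord_recl /= ket_coef0 mul1r !muln0 addn0 subn0.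
  rewrite big_add1 big_mkord.
  congr (_ * (_ + _)).
  by rewrite !fct_sumE.
rewrite exchange_big/=.
have [[t tm ->]|kt] := ladder_dec m k; last first.
  rewrite state_out//; apply: big1 => t _; apply: big1 => n _.
  suff -> : (k == m - 2 * t)%N = false by rewrite andbF !mulr0.
  by apply/eqP; apply: kt; have := ltn_ord t; lia.
have tm2 : (t < m./2.+1)%N by lia.
rewrite stateE// (bigD1 (Ordinal tm2))//= [X in _ + X]big1 ?addr0; last first.
  move=> i /eqP it; apply: big1 => n _.
  suff -> : (m - 2 * t == m - 2 * i)%N = false by rewrite andbF !mulr0.
  apply/negP => h; apply: it; apply: val_inj => /=.
  by have := ltn_ord i; lia.
rewrite eqxx; case: leqP => tj; last first.
  apply: big1 => n _; suff -> : (j == n + 3 * t)%N = false by rewrite !mulr0.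
  by lia.
have jtN : (j - 3 * t < N)%N by lia.
rewrite (bigD1 (Ordinal jtN))//= [X in _ + X]big1 ?addr0; last first.
  move=> i /eqP it.
  suff -> : (j == i + 3 * t)%N = false by rewrite !mulr0.
  by apply/negP => h; apply: it; apply: val_inj => /=; lia.
by rewrite subnK// eqxx mulr1 mulrC.
Qed.

(** * The eigenvalue equation *)

Lemma state_eigenstate (R : realType) (m : nat) (E : R) :
  is_eigenstate E (state R m (fun n => laguerre n (3 * m + 3)%:R (2 * E))).
Proof.
set L := fun n => _; set s := state R m L => j k.
pose prev n := if n is n'.+1 then L n' else 0.
have LS n : n.+1%:R * (n + (3 * m + 3)).+1%:R * L n.+1 =
    ((2 * n + (3 * m + 3) + 1)%:R - 2 * E) * L n - prev n.
  exact: laguerre_rec.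
have [[t tm ->{k}]|kt] := ladder_dec m k; last first.
  have s0 i : coef s i k = 0 by case: i => i //=; exact: state_out.
  (* If k is not of the form m - 2t, neither is k + 2, so all four terms vanish. *)
  have s2 i : coef s i (k%:Z + 2) = 0.
    rewrite (_ : k%:Z + 2 = (k + 2)%N); last by lia.
    case: i => i //=; apply: state_out => t tm kE.
    by apply: (kt t.+1); lia.
  by rewrite !s0 s2; ring.
have c1 : coef s (j%:Z - 1) (m - 2 * t)%N =
    if (3 * t < j)%N then ket_coef R m t * L (j - 3 * t).-1 else 0.
  case: j => [|j]; first by rewrite ltn0.
  rewrite (_ : j.+1%:Z - 1 = j); last by lia.
  rewrite /coef /s stateE// ltnS; case: leqP => // tj.
  by rewrite subSn.
have c2 : coef s (j%:Z + 1) (m - 2 * t)%N =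
    if (3 * t <= j.+1)%N then ket_coef R m t * L (j.+1 - 3 * t)%N else 0.
  by rewrite (_ : j%:Z + 1 = j.+1); [exact: stateE|lia].
(* Row k + 2 belongs to t - 1, and (j - 2) - 3(t - 1) = j + 1 - 3t: the same Laguerre index as in
   [c2]. *)
have c3 : coef s (j%:Z - 2) ((m - 2 * t)%N%:Z + 2) =
    if (0 < t)%N && (3 * t <= j.+1)%N
    then ket_coef R m t.-1 * L (j.+1 - 3 * t)%N else 0.
  case: j {c1 c2} => [|[|j]].
  - by rewrite (_ : _ && _ = false)//; lia.
  - by rewrite (_ : _ && _ = false)//; lia.
  rewrite (_ : j.+2%:Z - 2 = j); last by lia.
  rewrite (_ : (m - 2 * t)%N%:Z + 2 = (m - 2 * t + 2)%N); last by lia.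
  rewrite /coef; case: t tm => [|t] tm/=.
    by apply: state_out => t tm'; lia.
  rewrite (_ : (m - 2 * t.+1 + 2)%N = (m - 2 * t)%N); last by lia.
  rewrite /s stateE; last by lia.
  have -> : (3 * t.+1 <= j.+3)%N = (3 * t <= j)%N by lia.
  by have -> : (j.+3 - 3 * t.+1)%N = (j - 3 * t)%N by lia.
have c0 : coef s j%:Z (m - 2 * t)%N =
    if (3 * t <= j)%N then ket_coef R m t * L (j - 3 * t)%N else 0.
  exact: stateE.
rewrite c0 c1 c2 c3 {c0 c1 c2 c3 s}.
have [k mE] : exists k, m = (k + 2 * t)%N by exists (m - 2 * t)%N; lia.
have -> : (m - 2 * t = k)%N by lia.
(* Setting c_(-1) = 0 makes the relation [hD] valid at t = 0 too. *)
pose D := if (0 < t)%N then ket_coef R m t.-1 else 0.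
have hD : 3 * t%:R * (3 * (k + t + 1)%:R) * ket_coef R m t =
    - (3 / 8 * (k%:R + 1) * (k%:R + 2) * D).
  rewrite /D mE; case: (t) => [|t'] /=; first by rewrite !mulr0 !mul0r oppr0.
  by rewrite -ket_coef_rec (_ : k + t'.+1 + 1 = k + t' + 2)%N//; lia.
(* The recursion will be c_t times the Laguerre recurrence plus L_(n+1) times [hD]. *)
have combine (u v u' v' c l : R) : 
    u = v -> u' = v' -> c * (u - v) + (u' - v') * l = 0.
  by move=> -> ->; rewrite !subrr mulr0 mul0r addr0.
have [tj|jt] := leqP (3 * t) j.
  have [n jE] : exists n, j = (n + 3 * t)%N by exists (j - 3 * t)%N; lia.
  have -> : (3 * t <= j.+1)%N by lia.
  have -> : (j.+1 - 3 * t = n.+1)%N by lia.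
  have -> : (j - 3 * t = n)%N by lia.
  have -> : (3 * t < j)%N = (0 < n)%N by lia.
  rewrite andbT.
  rewrite [X in _ + X](_ : _ = 3 / 8 * (k%:R + 1) * (k%:R + 2) * D * L n.+1);
    last by rewrite /D; case: ifP => _; ring.
  rewrite [X in X - _](_ : _ = ket_coef R m t * prev n);
    last by case: (n) => [|n'] //=; rewrite mulr0.
  have := LS n; move: hD; rewrite jE mE.
  move: (ket_coef _ _ _) D (L n) (L n.+1) (prev n) => c d l l' p hD LSn.
  by apply: etrans (combine _ _ _ _ c l' LSn hD); ring.
(* only [j = 3t - 1], i.e. [n = -1], matters here: the terms in [L_0] cancel *)
have -> : (3 * t < j)%N = false by lia.
(* For j + 1 < 3t every coefficient is 0. *)
have [jt1|jt1] := leqP (3 * t) j.+1; last by rewrite andbF; ring.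
have -> : (0 < t)%N by lia.
have -> : (j.+1 - 3 * t)%N = 0%N by lia.
move: hD; rewrite /D (_ : 0 < t)%N; last by lia.
(* At n = -1 the summand (n + 1)(n + 3m + 4) is zero, leaving exactly the factor in [hD]. *)
have -> : (j%:R + 1) * (j%:R + 3 * k%:R + 4) = 3 * t%:R * (3 * (k + t + 1)%:R) :> R.
  have -> : j%:R = 3 * t%:R - 1 :> R.
    by apply/eqP; rewrite eq_sym subr_eq natr1 -natrM; apply/eqP; congr _%:R; lia.
  by ring.
move: (ket_coef _ _ _) (ket_coef _ _ _) (L 0%N) => c d l hD.
by apply: etrans (combine _ _ _ _ 0 l (erefl 0) hD) => /=; ring.
Qed.

(** * Identification with the two given series *)

Lemma eigenstateZ (R : realType) (E b : R) (s : fseries R) :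
  is_eigenstate E s -> is_eigenstate E (b *: s).
Proof.
move=> sE j k.
have bs j' k' : coef (b *: s) j' k' = b * coef s j' k'.
  by case: j' => j'; case: k' => k'; rewrite /coef ?mulr0.
by rewrite !bs -[RHS](mulr0 b) -(sE j k); ring.
Qed.

Lemma exprzN24 (R : realType) (kappa t : nat) : (t <= kappa)%N ->
  (- 24%:R) ^ ((kappa - t)%N%:Z - kappa%:Z) = ((- 24%:R) ^+ t)^-1 :> R.
Proof.
by move=> tk; rewrite (_ : _ - kappa%:Z = - t%:Z) -?exprnN//; lia.
Qed.

(** At index kappa - t the factorials of [GammaEven] become (m - t)!, t! and (m - 2t)!, which gives
    c_t. *)
Lemma even_termE (R : realType) (kappa : nat) (E : R) (m := (2 * kappa)%N) :
  even_term kappa E = fun n => laguerre n (3 * m + 3)%:R (2 * E) *: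
    (ket R n m + \sum_(1 <= t < m./2.+1)
       ket_coef R m t *: ket R (n + 3 * t) (m - 2 * t)).
Proof.
apply/funext => n; rewrite /even_term /m.
have -> : (6 * kappa + 3 = 3 * (2 * kappa) + 3)%N by lia.
have -> : ((2 * kappa)./2 = kappa)%N by lia.
congr (_ *: (_ + _)); apply: eq_big_nat => t /andP[_ tk].
congr (_ *: _); rewrite /GammaEven /ket_coef exprzN24//.
by congr (_ * (_`!%:R / (_`!%:R * _`!%:R))); lia.
Qed.

(** The extra 1 in the factorials of [GammaOdd] is absorbed by m = 2 kappa + 1, giving the same
    c_t. *)
Lemma odd_termE (R : realType) (kappa : nat) (E : R) (m := (2 * kappa + 1)%N) :
  odd_term kappa E = fun n => laguerre n (3 * m + 3)%:R (2 * E) *: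
    (ket R n m + \sum_(1 <= t < m./2.+1)
       ket_coef R m t *: ket R (n + 3 * t) (m - 2 * t)).
Proof.
apply/funext => n; rewrite /odd_term /m.
have -> : (6 * kappa + 6 = 3 * (2 * kappa + 1) + 3)%N by lia.
have -> : ((2 * kappa + 1)./2 = kappa)%N by lia.
congr (_ *: (_ + _)); apply: eq_big_nat => t /andP[_ tk].
have -> : (2 * kappa + 1 - 2 * t = 2 * kappa - 2 * t + 1)%N by lia.
congr (_ *: _); rewrite /GammaOdd /ket_coef exprzN24//.
by congr (_ * (_`!%:R / (_`!%:R * _`!%:R))); lia.
Qed.

Theorem mainTheorem4 (R : realType) (kappa : nat) (E : R) (hE : 0 < E) :
  (exists a : fseries R, is_even_state kappa E a /\ is_eigenstate E a) /\
  (exists a : fseries R, is_odd_state kappa E a /\ is_eigenstate E a).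
Proof.
(* One family serves both series, at m = 2 kappa and m = 2 kappa + 1; the prefactors enter by
   linearity. *)
pose s m := state R m (fun n => laguerre n (3 * m + 3)%:R (2 * E)).
split.
- exists (((2 * E) ^+ (3 * kappa) * expR (- E)) *: s (2 * kappa)%N); split.
    exists (s (2 * kappa)%N) => //.
    by rewrite even_termE; exact: state_formal_sum.
  by apply: eigenstateZ; exact: state_eigenstate.
- exists (((2 * E) `^ (3 * kappa%:R + 3 / 2) * expR (- E)) *:
    s (2 * kappa + 1)%N); split.
    exists (s (2 * kappa + 1)%N) => //.
    by rewrite odd_termE; exact: state_formal_sum.
  by apply: eigenstateZ; exact: state_eigenstate.
Qed.
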